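(* Let $n\ge 2$, let $V=\mathbb{C}^{n^2}$ with coordinates $x^i_j$ ($1\le i,j\le n$), and let $\mathcal{I}=\mathcal{I}^{\mathrm{perm}_n,2}\subset \mathrm{Sym}(V)=\mathbb{C}[x^i_j]$ be the ideal generated by all $2\times 2$ sub-permanents $x^i_jx^k_l+x^i_lx^k_j$ of the $n\times n$ matrix $(x^i_j)$. Write $\mathcal{I}_t$ for its degree $t$ component. Then $\dim\mathcal{I}_2=\binom n2^2$. For $3\le t\le n$, $$\dim\mathcal{I}_t=\binom{n^2+t-1}{t}-\Big[\binom nt^2+n^2+(t-1)\Big(\binom{n^2}{2}-\binom n2^2\Big)+2\binom{t-1}{2}\Big(\binom n2^2+n\binom n3\Big)+2n\sum_{j=3}^{t-1}\binom{t-1}{j}\binom{n}{j+1}\Big],$$ and for $t>n$, $$\dim\mathcal{I}_t=\binom{n^2+t-1}{t}-\Big[n^2+(t-1)\Big(\binom{n^2}{2}-\binom n2^2\Big)+2\binom{t-1}{2}\Big(\binom n2^2+n\binom n3\Big)+2n\sum_{j=3}^{t-1}\binom{t-1}{j}\binom{n}{j+1}\Big].$$ The latter formula equals $\dim S^t\mathbb{C}^{n^2}$ minus the value at $t$ of the Hilbert polynomial of $\mathrm{Sym}(V)/\mathcal{I}$. *)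

(* Defs.v *)
From HB Require Import structures.
From mathcomp Require Import all_boot all_order all_algebra.
From mathcomp Require Import boolp reals.
From mathcomp Require Import complex.
From mathcomp Require Import mpoly.

Set Implicit Arguments.
Unset Strict Implicit.
Unset Printing Implicit Defensive.

Import Order.TTheory GRing.Theory Num.Theory.
Local Open Scope ring_scope.

(* Sym^t(F^N): the homogeneous polynomials of degree t in N variables. The
   library gives [dhomog] a finite-dimensional structure only when N is
   syntactically a successor; the alias provides it for every N. *)
Definition sym_pow (F : fieldType) (N t : nat) : Type := dhomog N F t.

HB.instance Definition _ (F : fieldType) (N t : nat) :=
  GRing.Lmodule.on (sym_pow F N t).

Lemma sym_pow_vect_axiom (F : fieldType) (N t : nat) :
  Vector.axiom 'C((N + t).-1, t) (sym_pow F N t).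
Proof.
case: N => [|N]; last first.
  by rewrite addSn /= addnC; exact: dhomog_vecaxiom.
rewrite add0n; exists (fun p => \row_(i < 'C(t.-1, t)) (mpoly_of_dhomog p)@_0%MM).
  by move=> c p q; apply/matrixP=> i j; rewrite !mxE /= mcoeffD mcoeffZ.
have mnm0E (m : 'X_{1..0}) : m = 0%MM by apply/mnmP; case.
case: t => [|t].
  have h1 (r : 'rV[F]_('C(0, 0))) : (r 0 ord0)%:MP_[0] \is 0.-homog.
    by rewrite -[_%:MP_[0]]mulr1 mul_mpolyC rpredZ // dhomog1.
  exists (fun r => DHomog (h1 r)).
    by move=> p; apply/val_inj/mpolyP => m /=; rewrite mcoeffC mxE (mnm0E m) eqxx mulr1.
  move=> r; apply/matrixP=> i j; rewrite !mxE /= mcoeffC eqxx mulr1.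
  by rewrite !ord1.
exists (fun=> 0).
  move=> p; apply/val_inj/mpolyP => m /=; rewrite mcoeff0.
  apply/esym/(@dhomog_nemf_coeff _ _ mdeg t.+1); first exact: dhomog_is_dhomog.
  by rewrite (mnm0E m) mf0.
by move=> r; apply/matrixP=> i [j lj]; exfalso; move: lj; rewrite bin_small.
Qed.

HB.instance Definition _ (F : fieldType) (N t : nat) :=
  Lmodule_hasFinDim.Build F (sym_pow F N t) (@sym_pow_vect_axiom F N t).

Definition sym_pow_val (F : fieldType) (N t : nat) (p : sym_pow F N t) :
  {mpoly F[N]} := mpoly_of_dhomog p.

Definition ideal_gen (S : comNzRingType) (G : S -> Prop) (p : S) : Prop :=
  exists s : seq (S * S),
    (forall u, u \in s -> G u.2) /\ p = \sum_(u <- s) u.1 * u.2.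

Section IdealComponent.
Context (F : fieldType) (N : nat) (G : {mpoly F[N]} -> Prop).

Lemma ideal_gen0 : ideal_gen G 0.
Proof. by exists [::]; rewrite big_nil. Qed.

Lemma ideal_genD p q : ideal_gen G p -> ideal_gen G q -> ideal_gen G (p + q).
Proof.
move=> [s [Gs ->]] [r [Gr ->]]; exists (s ++ r); rewrite big_cat; split=> // u.
by rewrite mem_cat => /orP[/Gs|/Gr].
Qed.

Lemma ideal_genM a p : ideal_gen G p -> ideal_gen G (a * p).
Proof.
move=> [s [Gs ->]]; exists [seq (a * u.1, u.2) | u <- s]; split.
  by move=> u /mapP[v /Gs Gv ->].
by rewrite big_map mulr_sumr; apply: eq_bigr => u _; rewrite mulrA.
Qed.

Lemma ideal_component_ex (t : nat) :
  exists U : {vspace sym_pow F N t},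
    forall p, p \in U <-> ideal_gen G (sym_pow_val p).
Proof.
pose sub (U : {vspace sym_pow F N t}) :=
  forall p, p \in U -> ideal_gen G (sym_pow_val p).
pose P d := `[< exists2 U, sub U & \dim U = d >].
have exP : exists d, P d.
  exists (\dim (0%VS : {vspace sym_pow F N t})); apply/asboolP.
  by exists 0%VS => // p; rewrite memv0 => /eqP->; exact: ideal_gen0.
have leP d : P d -> (d <= \dim {:sym_pow F N t})%N.
  by move=> /asboolP[U _ <-]; rewrite dimvS ?subvf.
case: (ex_maxnP exP leP) => d /asboolP[U subU <-] maxU.
exists U => p; split=> [|Ip]; first exact: subU.
have subUp : sub (U + <[p]>)%VS.
  move=> q /memv_addP[u uU [v /vlineP[c ->] ->]].
  have -> : sym_pow_val (u + c *: p) = sym_pow_val u + c%:MP * sym_pow_val p.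
    by rewrite mul_mpolyC.
  by apply: ideal_genD; [exact: subU | exact: ideal_genM].
have /maxU le_dim : P (\dim (U + <[p]>)%VS) by apply/asboolP; exists (U + <[p]>)%VS.
have /eqP-> : U == (U + <[p]>)%VS by rewrite eqEdim addvSl.
by rewrite memvE addvSr.
Qed.

(* The degree t component of the ideal generated by G, as a subspace of
   Sym^t(F^N); it is characterised by [mem_ideal_component]. *)
Definition ideal_component (t : nat) : {vspace sym_pow F N t} :=
  sval (cid (ideal_component_ex t)).

Lemma mem_ideal_component (t : nat) (p : sym_pow F N t) :
  p \in ideal_component t <-> ideal_gen G (sym_pow_val p).
Proof. exact: (svalP (cid (ideal_component_ex t))). Qed.

(* The Hilbert function of the quotient by the ideal generated by G, i.e. the
   dimension of Sym^t(F^N) modulo the degree t component of the ideal; see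
   [dim_quotient_component]. *)
Definition hilbert_function (t : nat) : nat :=
  (\dim {:sym_pow F N t} - \dim (ideal_component t))%N.

Lemma dim_quotient_component (t : nat) (W : vectType F)
    (pi : 'Hom(sym_pow F N t, W)) :
  limg pi = fullv -> lker pi = ideal_component t ->
  \dim {:W} = hilbert_function t.
Proof.
move=> pi_surj pi_ker; rewrite /hilbert_function -pi_surj -pi_ker.
by rewrite -(limg_ker_dim pi fullv) capfv addKn.
Qed.

Definition is_hilbert_polynomial (P : {poly rat}) : Prop :=
  exists t0 : nat, forall t : nat, (t0 <= t)%N ->
    (hilbert_function t)%:R = P.[t%:R].

End IdealComponent.

(* The coordinate x^i_j on the space of n x n matrices; [mxvec_index] is the
   library's bijection from pairs (i, j) to 'I_(n * n). *)
Definition coord_var (F : fieldType) (n : nat) (i j : 'I_n) :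
  {mpoly F[n * n]} := 'X_(mxvec_index i j).

Definition sub_permanent2 (F : fieldType) (n : nat) (p : {mpoly F[n * n]}) :
  Prop :=
  exists i k j l : 'I_n, [/\ (i < k)%N, (j < l)%N &
    p = coord_var F i j * coord_var F k l + coord_var F i l * coord_var F k j].

Definition perm_ideal_component (F : fieldType) (n t : nat) :
  {vspace sym_pow F (n * n) t} := ideal_component (@sub_permanent2 F n) t.

Definition dim_formula_small (n t : nat) : int :=
  'C(n ^ 2 + t - 1, t)%:Z
  - ('C(n, t)%:Z ^+ 2 + n%:Z ^+ 2
     + (t%:Z - 1) * ('C(n ^ 2, 2)%:Z - 'C(n, 2)%:Z ^+ 2)
     + 2 * 'C(t - 1, 2)%:Z * ('C(n, 2)%:Z ^+ 2 + n%:Z * 'C(n, 3)%:Z)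
     + 2 * n%:Z * \sum_(3 <= j < t) 'C(t - 1, j)%:Z * 'C(n, j + 1)%:Z).

Definition dim_formula_large (n t : nat) : int :=
  'C(n ^ 2 + t - 1, t)%:Z
  - (n%:Z ^+ 2
     + (t%:Z - 1) * ('C(n ^ 2, 2)%:Z - 'C(n, 2)%:Z ^+ 2)
     + 2 * 'C(t - 1, 2)%:Z * ('C(n, 2)%:Z ^+ 2 + n%:Z * 'C(n, 3)%:Z)
     + 2 * n%:Z * \sum_(3 <= j < t) 'C(t - 1, j)%:Z * 'C(n, j + 1)%:Z).

(* Main.v *)
Require Import Defs.
From HB Require Import structures.
From mathcomp Require Import all_boot all_order all_algebra.
From mathcomp Require Import reals.
From mathcomp Require Import complex.
From mathcomp Require Import mpoly.
From mathcomp Require Import zify ring.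

(** Identify a monomial with the n x n matrix of its exponents. Modulo the ideal,
    x_ij x_kl = - x_il x_kj, so a monomial changes only by a sign when a swap
    e_ij + e_kl -> e_il + e_kj is applied, and swaps connect all nonnegative
    integer matrices with given row and column sums. Hence for every pair of
    margins the quotient is at most one-dimensional. It is zero as soon as some
    matrix with these margins dominates the pattern of x_ij x_il x_kq (or its
    transpose), since three swaps map that pattern to minus itself. The margins
    that remain are those supported on one row or one column, those supported on a
    2 x 2 block, and those with entries 0 and 1 only; for them a consistent sign
    exists (trivial, parity of a corner entry, parity of inversions), so the
    quotient is one-dimensional. The Hilbert function in degree t thus counts
    pairs of compositions of t into n parts by support size, and there are
    C(n,s) C(t-1,s-1) compositions with support of size s. *)

Set Implicit Arguments.
Unset Strict Implicit.
Unset Printing Implicit Defensive.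

Import Order.TTheory GRing.Theory Num.Theory.
Local Open Scope ring_scope.

(** * Margins and swaps *)

Section Margins.
Context (n : nat).
Implicit Types (m : 'X_{1..n * n}) (i j k l : 'I_n).

Lemma mxvec_index_eq i j k l :
  (mxvec_index i j == mxvec_index k l) = (i == k) && (j == l).
Proof.
by rewrite /mxvec_index (inj_eq (@cast_ord_inj _ _ _)) (inj_eq enum_rank_inj).
Qed.

Lemma sum_mxvec_index (f : 'I_(n * n) -> nat) :
  (\sum_a f a = \sum_i \sum_j f (mxvec_index i j))%N.
Proof.
rewrite (reindex _ (curry_mxvec_bij n n)) pair_bigA /=.
by apply: eq_bigr => -[].
Qed.

Lemma addmAC m m1 m2 : (m + m1 + m2 = m + m2 + m1)%MM.
Proof. by rewrite -!addmA [(m1 + m2)%MM]addmC. Qed.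

Definition unitm i j : 'X_{1..n * n} := U_(mxvec_index i j)%MM.

Definition row_sum m i : nat := (\sum_j m (mxvec_index i j))%N.
Definition col_sum m j : nat := (\sum_i m (mxvec_index i j))%N.

Lemma unitmE i j k l : unitm i j (mxvec_index k l) = (i == k) && (j == l) :> nat.
Proof. by rewrite mnm1E mxvec_index_eq. Qed.

Lemma row_sumD m m' i : row_sum (m + m')%MM i = (row_sum m i + row_sum m' i)%N.
Proof. by rewrite -big_split; apply: eq_bigr => j _; rewrite mnmDE. Qed.

Lemma col_sumD m m' j : col_sum (m + m')%MM j = (col_sum m j + col_sum m' j)%N.
Proof. by rewrite -big_split; apply: eq_bigr => i _; rewrite mnmDE. Qed.

Lemma row_sum_unitm i j k : row_sum (unitm i j) k = (i == k) :> nat.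
Proof.
rewrite /row_sum (bigD1 j) //= unitmE eqxx andbT big1 ?addn0 // => l nlj.
by rewrite unitmE [j == l]eq_sym (negPf nlj) andbF.
Qed.

Lemma col_sum_unitm i j l : col_sum (unitm i j) l = (j == l) :> nat.
Proof.
rewrite /col_sum (bigD1 i) //= unitmE eqxx big1 ?addn0 // => k nki.
by rewrite unitmE [i == k]eq_sym (negPf nki).
Qed.

Lemma mdeg_row_sum m : mdeg m = (\sum_i row_sum m i)%N.
Proof. by rewrite mdegE sum_mxvec_index. Qed.

Lemma mdeg_col_sum m : mdeg m = (\sum_j col_sum m j)%N.
Proof. by rewrite mdegE sum_mxvec_index exchange_big. Qed.

Lemma sum_gt0 (I : finType) (f : I -> nat) :
  (0 < \sum_x f x)%N -> exists x, (0 < f x)%N.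
Proof.
rewrite lt0n sum_nat_eq0 negb_forall => /existsP[x].
by rewrite implyTb -lt0n; exists x.
Qed.

Lemma unitmK m i j : (0 < m (mxvec_index i j))%N ->
  exists m', m = (m' + unitm i j)%MM.
Proof.
by move=> m0; exists (m - unitm i j)%MM; rewrite submK // lep1mP -lt0n.
Qed.

Definition same_margins m m' :=
  row_sum m =1 row_sum m' /\ col_sum m =1 col_sum m'.

Lemma same_marginsD2r m m' p :
  same_margins (m + p)%MM (m' + p)%MM <-> same_margins m m'.
Proof.
split=> -[r c]; split=> i.
- by move: (r i); rewrite !row_sumD => /addIn.
- by move: (c i); rewrite !col_sumD => /addIn.
- by rewrite !row_sumD r.
- by rewrite !col_sumD c.
Qed.

Lemma same_margins_swap m i j k l :
  same_margins (m + unitm i j + unitm k l)%MM (m + unitm i l + unitm k j)%MM.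
Proof.
by split=> a; rewrite ?row_sumD ?col_sumD ?row_sum_unitm ?col_sum_unitm // addnAC.
Qed.

Lemma same_margins_sym m m' : same_margins m m' -> same_margins m' m.
Proof. by case=> r c; split=> a; rewrite ?r ?c. Qed.

Lemma same_margins_trans m1 m2 m3 :
  same_margins m1 m2 -> same_margins m2 m3 -> same_margins m1 m3.
Proof. by move=> [r c] [r' c']; split=> a; rewrite ?r ?c. Qed.

(** Induction on the common total: while it is positive, some row and some column still have room,
    and a unit placed where they cross lowers both margins by one. *)
Lemma exists_margins (r c : 'I_n -> nat) : (\sum_i r i = \sum_j c j)%N ->
  exists m, row_sum m =1 r /\ col_sum m =1 c.
Proof.
move sr : (\sum_i r i)%N => t.
elim: t => [|t IH] in r c sr *; move=> sc.
  exists 0%MM; split=> i; rewrite [LHS]big1 => [|j _]; rewrite ?mnm0E //.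
    by apply/esym/eqP; move/eqP: sr; rewrite sum_nat_eq0 => /forallP/(_ i).
  by apply/esym/eqP; move/esym/eqP: sc; rewrite sum_nat_eq0 => /forallP/(_ i).
have [i ri] : exists i, (0 < r i)%N by apply: sum_gt0; rewrite sr.
have [j cj] : exists j, (0 < c j)%N by apply: sum_gt0; rewrite -sc.
have sumB (f : 'I_n -> nat) a : (0 < f a)%N ->
    (\sum_b f b = (\sum_b (f b - (a == b))).+1)%N.
  move=> fa; rewrite (bigD1 a) // [in RHS](bigD1 a) //= eqxx -addSn subn1 prednK //.
  by congr addn; apply: eq_bigr => b nb; rewrite eq_sym (negPf nb) subn0.
have [||m [rm cm]] := IH (fun b => r b - (i == b))%N (fun b => c b - (j == b))%N.
- by move: sr; rewrite (sumB _ _ ri) => -[].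
- by move: sc; rewrite (sumB _ _ cj) => -[].
exists (m + unitm i j)%MM; split=> a.
  by rewrite row_sumD row_sum_unitm rm subnK //; case: eqP => // <-.
by rewrite col_sumD col_sum_unitm cm subnK //; case: eqP => // <-.
Qed.

End Margins.

(** * Relations between monomials modulo the ideal *)

Section PermanentIdeal.
Context (F : fieldType) (n : nat).
Implicit Types (m : 'X_{1..n * n}) (i j k l : 'I_n).

Local Notation in_ideal := (ideal_gen (@sub_permanent2 F n)).
Local Notation x := (coord_var F).

Lemma ideal_genN p : in_ideal p -> in_ideal (- p).
Proof. by move=> Ip; rewrite -mulN1r; apply: ideal_genM. Qed.

Lemma ideal_gen_double p : 2%:R != 0 :> F -> in_ideal (p + p) -> in_ideal p.
Proof.
move=> F2 /(ideal_genM (2%:R^-1)%:MP).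
by rewrite mul_mpolyC -mulr2n -scaler_nat scalerA mulVf // scale1r.
Qed.

(** A 2 x 2 permanent is unchanged when its rows or its columns are exchanged, so the index
    orderings required of a generator can be relaxed to distinctness. *)
Lemma sub_permanent2_in_ideal i j k l : i != k -> j != l ->
  in_ideal (x i j * x k l + x i l * x k j).
Proof.
have gen i' k' j' l' : (i' < k')%N -> (j' < l')%N ->
    in_ideal (x i' j' * x k' l' + x i' l' * x k' j').
  move=> ik jl; exists [:: (1, x i' j' * x k' l' + x i' l' * x k' j')].
  rewrite big_seq1 mul1r; split=> // u; rewrite inE => /eqP->.
  by exists i', k', j', l'.
rewrite -!(inj_eq val_inj) !neq_ltn => /orP[] ik /orP[] jl.
- exact: gen.
- by rewrite addrC; apply: gen.
- by rewrite addrC mulrC [X in _ + X]mulrC; apply: gen.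
- by rewrite mulrC [X in _ + X]mulrC; apply: gen.
Qed.

Lemma mpolyX_unitm m i j : 'X_[m + unitm i j] = 'X_[m] * x i j.
Proof. by rewrite mpolyXD. Qed.

Lemma mpolyX_swap m i j k l : i != k -> j != l ->
  in_ideal ('X_[m + unitm i j + unitm k l] + 'X_[m + unitm i l + unitm k j]).
Proof.
move=> ik jl; rewrite !mpolyX_unitm -!mulrA -mulrDr.
by apply: ideal_genM; apply: sub_permanent2_in_ideal.
Qed.

(* Three swaps take the monomial back to itself and reverse its sign. *)
Lemma mpolyX_row_pattern m i k j l q : 2%:R != 0 :> F -> i != k ->
    j != l -> l != q -> q != j ->
  in_ideal 'X_[m + unitm i j + unitm i l + unitm k q].
Proof.
move=> F2 ik jl lq qj; rewrite !mpolyX_unitm.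
apply: ideal_gen_double => //.
have -> : 'X_[m] * x i j * x i l * x k q + 'X_[m] * x i j * x i l * x k q =
    'X_[m] * x i j * (x i l * x k q + x i q * x k l)
  + ('X_[m] * x i l * (x i q * x k j + x i j * x k q)
  - 'X_[m] * x i q * (x i j * x k l + x i l * x k j)).
  ring.
do 2?[apply: ideal_genD]; last apply: ideal_genN.
all: by apply: ideal_genM; apply: sub_permanent2_in_ideal; rewrite // eq_sym.
Qed.

(** The transpose of [mpolyX_row_pattern], by the same three swaps. *)
Lemma mpolyX_col_pattern m i k j l q : 2%:R != 0 :> F -> i != k ->
    j != l -> l != q -> q != j ->
  in_ideal 'X_[m + unitm j i + unitm l i + unitm q k].
Proof.
move=> F2 ik jl lq qj; rewrite !mpolyX_unitm.
apply: ideal_gen_double => //.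
have -> : 'X_[m] * x j i * x l i * x q k + 'X_[m] * x j i * x l i * x q k =
    'X_[m] * x j i * (x l i * x q k + x l k * x q i)
  + ('X_[m] * x l i * (x q i * x j k + x q k * x j i)
  - 'X_[m] * x q i * (x j i * x l k + x j k * x l i)).
  ring.
do 2?[apply: ideal_genD]; last apply: ideal_genN.
all: by apply: ideal_genM; apply: sub_permanent2_in_ideal; rewrite // eq_sym.
Qed.

(* Nonnegative integer matrices with equal margins are connected by swaps. *)
Lemma same_margins_eq_mod m m' : same_margins m m' ->
  exists b : bool, in_ideal ('X_[m] - (-1) ^+ b * 'X_[m']).
Proof.
move sm : (mdeg m) => t.
elim: t => [|t IH] in m m' sm *.
  move=> [rm _]; exists false; rewrite expr0 mul1r.
  have sm' : mdeg m' = 0%N.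
    by rewrite -sm !mdeg_row_sum; apply: eq_bigr => i _; rewrite rm.
  move/eqP: sm; move/eqP: sm'; rewrite !mdeg_eq0 => /eqP-> /eqP->.
  by rewrite subrr; apply: ideal_gen0.
(* A cell occupied in both matrices can be removed from both, which lowers the degree and lets the
   induction hypothesis apply. *)
have step i j m1 m2 : mdeg (m1 + unitm i j)%MM = t.+1 ->
    same_margins (m1 + unitm i j)%MM (m2 + unitm i j)%MM ->
    exists b : bool, in_ideal ('X_[m1 + unitm i j] - (-1) ^+ b * 'X_[m2 + unitm i j]).
  rewrite mdegD mdeg1 addn1 => -[s1] /same_marginsD2r/(IH _ _ s1)[b Ib].
  by exists b; rewrite !mpolyX_unitm mulrA -mulrBl mulrC; apply: ideal_genM.
move=> eq_mm'; have [rm cm] := eq_mm'.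
have sm' : mdeg m' = t.+1.
  by rewrite -sm !mdeg_row_sum; apply: eq_bigr => i _; rewrite rm.
have [i ri] : exists i, (0 < row_sum m' i)%N.
  by apply: sum_gt0; rewrite -mdeg_row_sum sm'.
have [j m'ij] := sum_gt0 ri; have [m2 def_m'] := unitmK m'ij.
have [mij|] := boolP (0 < m (mxvec_index i j))%N.
  have [m1 def_m] := unitmK mij; subst m m'; exact: step.
(* The cell (i, j) is empty in [m], but row i and column j of [m] are not. Swapping
   [unitm i l + unitm k j] for [unitm i j + unitm k l] fills the cell shared with [m']. *)
rewrite -eqn0Ngt => /eqP m0.
have [l mil] : exists l, (0 < m (mxvec_index i l))%N.
  apply: sum_gt0; rewrite -/(row_sum m i) rm def_m' row_sumD row_sum_unitm.
  by rewrite eqxx addn1.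
have [k mkj] : exists k, (0 < m (mxvec_index k j))%N.
  apply: sum_gt0; rewrite -/(col_sum m j) cm def_m' col_sumD col_sum_unitm.
  by rewrite eqxx addn1.
have ik : i != k by apply: contraTneq mkj => <-; rewrite m0.
have jl : l != j by apply: contraTneq mil => ->; rewrite m0.
have [m1 def_m1] := unitmK mkj.
have [m3 def_m3] : exists m3, m1 = (m3 + unitm i l)%MM.
  apply: unitmK; move: mil; rewrite def_m1 mnmDE unitmE eq_sym (negPf ik).
  by rewrite addn0.
have swp := mpolyX_swap m3 ik jl.
rewrite def_m1 def_m3 in sm eq_mm' *.
have eq_m := same_margins_trans (same_margins_sym (same_margins_swap m3 i l k j)) eq_mm'.
rewrite addmAC def_m' in eq_m *.
have [|b Ib] := step i j _ _ _ eq_m.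
  by move: sm; rewrite !mdegD !mdeg1.
(* The swap contributes one extra sign. *)
exists (~~ b); rewrite signrN mulNr opprK.
move: (ideal_genD swp (ideal_genN Ib)); rewrite opprB.
rewrite [(m3 + unitm i j + unitm k l)%MM]addmAC.
by rewrite addrACA subrr addr0.
Qed.

End PermanentIdeal.

(** * Vanishing monomials *)

Section GoodMargins.
Context (n : nat).
Implicit Types (m : 'X_{1..n * n}) (i j k l : 'I_n) (f r c : 'I_n -> nat).

Definition supp_size f : nat := #|[pred i | 0 < f i]%N|.

(** When [r] and [c] have total [t], a support of size [t] means that all entries are 0 or 1. *)
Definition good_margins t r c : bool :=
  [|| supp_size r == 1, supp_size c == 1,
      (supp_size r == 2) && (supp_size c == 2)
    | (supp_size r == t) && (supp_size c == t)]%N.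

Lemma eq_supp_size f f' : f =1 f' -> supp_size f = supp_size f'.
Proof. by move=> eqf; apply: eq_card => i; rewrite !inE eqf. Qed.

Lemma eq_good_margins t r r' c c' :
  r =1 r' -> c =1 c' -> good_margins t r c = good_margins t r' c'.
Proof.
by move=> /eq_supp_size er /eq_supp_size ec; rewrite /good_margins er ec.
Qed.

Lemma supp_size_gt0 f : (0 < \sum_i f i)%N -> (0 < supp_size f)%N.
Proof. by case/sum_gt0=> i fi; apply/card_gt0P; exists i; rewrite inE. Qed.

Lemma supp_size_le f : (supp_size f <= \sum_i f i)%N.
Proof.
rewrite /supp_size -sum1_card big_mkcond /=; apply: leq_sum => i _.
by rewrite inE; case: (f i).
Qed.

Lemma supp_size_ltP f :
  reflect (exists i, (1 < f i)%N) (supp_size f != \sum_i f i)%N.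
Proof.
apply: (iffP idP) => [|[i fi]]; last first.
  rewrite neq_ltn; apply/orP; left; rewrite /supp_size -sum1_card big_mkcond /=.
  rewrite (bigD1 i) // [X in (_ < X)%N](bigD1 i) //= -addSn leq_add //.
    by rewrite inE; case: (f i) fi.
  by apply: leq_sum => j _; rewrite inE; case: (f j).
move=> ne; apply/existsP; apply: contraNT ne; rewrite negb_exists => /forallP nf.
rewrite /supp_size -sum1_card big_mkcond /=; apply/eqP; apply: eq_bigr => i _; rewrite inE; case Ef: (f i) => [|[|v]] //.
by move: (nf i); rewrite Ef.
Qed.

Lemma supp_size_other f i : (1 < supp_size f)%N ->
  exists2 k, k != i & (0 < f k)%N.
Proof.
case/card_gt1P=> k [l [fk fl kl]]; rewrite !inE in fk fl.
by have [eki|] := eqVneq k i; [exists l; rewrite // -eki eq_sym | exists k].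
Qed.

(** The residual margins have equal totals, because the row sums and the column sums of [m] both add
    up to its degree; [exists_margins] then fills the residue. *)
Lemma exists_margins_ge (r c : 'I_n -> nat) m : (\sum_i r i = \sum_j c j)%N ->
    (forall i, row_sum m i <= r i)%N -> (forall j, col_sum m j <= c j)%N ->
  exists m', row_sum (m' + m)%MM =1 r /\ col_sum (m' + m)%MM =1 c.
Proof.
move=> rc mr mc.
have [|m' [rm' cm']] := @exists_margins n (fun i => r i - row_sum m i)%N
    (fun j => c j - col_sum m j)%N.
  by rewrite !sumnB // rc -mdeg_row_sum mdeg_col_sum.
by exists m'; split=> a; rewrite ?row_sumD ?col_sumD ?rm' ?cm' subnK.
Qed.

End GoodMargins.

Section BadMargins.
Context (F : fieldType) (n : nat).
Implicit Types (m : 'X_{1..n * n}) (i j k l : 'I_n).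

Local Notation in_ideal := (ideal_gen (@sub_permanent2 F n)).

Lemma same_margins_in_ideal m m' :
  same_margins m m' -> in_ideal 'X_[m'] -> in_ideal 'X_[m].
Proof.
move=> /(@same_margins_eq_mod F)[b Ib] /(ideal_genM ((-1) ^+ b)) I'.
by move: (ideal_genD Ib I'); rewrite subrK.
Qed.

(** Some matrix with the margins of [m] contains [p] entrywise, and its monomial agrees with that of
    [m] up to sign modulo the ideal. *)
Lemma pattern_in_ideal m p :
    (forall i, row_sum p i <= row_sum m i)%N ->
    (forall j, col_sum p j <= col_sum m j)%N ->
    (forall m', in_ideal 'X_[m' + p]) ->
  in_ideal 'X_[m].
Proof.
move=> rp cp Ip; have [|m' [rm cm]] := exists_margins_ge _ rp cp.
  by rewrite -mdeg_row_sum mdeg_col_sum.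
by apply: same_margins_in_ideal (Ip m'); split=> a; rewrite ?rm ?cm.
Qed.

(** A row sum of at least 2, a second nonzero row and three nonzero columns leave room for the row
    pattern; the transposed conditions leave room for the column pattern. Bad margins always satisfy
    one of the two sets of conditions. *)
Lemma bad_margins_in_ideal m : 2%:R != 0 :> F -> (0 < mdeg m)%N ->
  ~~ good_margins (mdeg m) (row_sum m) (col_sum m) -> in_ideal 'X_[m].
Proof.
move=> F2 m0; set r := row_sum m; set c := col_sum m.
have sr : (\sum_i r i = mdeg m)%N by rewrite mdeg_row_sum.
have sc : (\sum_i c i = mdeg m)%N by rewrite mdeg_col_sum.
have r0 : (0 < supp_size r)%N by rewrite supp_size_gt0 ?sr.
have c0 : (0 < supp_size c)%N by rewrite supp_size_gt0 ?sc.
have r_le : (supp_size r <= mdeg m)%N by rewrite -sr supp_size_le.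
have c_le : (supp_size c <= mdeg m)%N by rewrite -sc supp_size_le.
move=> bad.
have row_case : (exists i, (1 < r i)%N) -> (1 < supp_size r)%N ->
    (2 < supp_size c)%N -> in_ideal 'X_[m].
  case=> i ri /(supp_size_other i)[k ki rk] /card_gt2P[j [l [q]]] [[]].
  rewrite !inE => cj cl cq [jl lq qj].
  apply: (@pattern_in_ideal _ (unitm i j + unitm i l + unitm k q)%MM) => [a|a|m'].
  - rewrite !row_sumD !row_sum_unitm -/(r a).
    have [<-|_] := eqVneq i a; first by rewrite (negPf ki).
    by have [<-|] := eqVneq k a.
  - rewrite !col_sumD !col_sum_unitm -/(c a).
    have [<-|_] := eqVneq j a; first by rewrite eq_sym (negPf jl) (negPf qj).
    have [<-|_] := eqVneq l a; first by rewrite eq_sym (negPf lq).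
    by have [<-|] := eqVneq q a.
  - by rewrite !addmA; apply: mpolyX_row_pattern; rewrite // eq_sym.
have col_case : (exists i, (1 < c i)%N) -> (1 < supp_size c)%N ->
    (2 < supp_size r)%N -> in_ideal 'X_[m].
  case=> i ci /(supp_size_other i)[k ki ck] /card_gt2P[j [l [q]]] [[]].
  rewrite !inE => rj rl rq [jl lq qj].
  apply: (@pattern_in_ideal _ (unitm j i + unitm l i + unitm q k)%MM) => [a|a|m'].
  - rewrite !row_sumD !row_sum_unitm -/(r a).
    have [<-|_] := eqVneq j a; first by rewrite eq_sym (negPf jl) (negPf qj).
    have [<-|_] := eqVneq l a; first by rewrite eq_sym (negPf lq).
    by have [<-|] := eqVneq q a.
  - rewrite !col_sumD !col_sum_unitm -/(c a).
    have [<-|_] := eqVneq i a; first by rewrite (negPf ki).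
    by have [<-|] := eqVneq k a.
  - by rewrite !addmA; apply: mpolyX_col_pattern; rewrite // eq_sym.
have row2 : (supp_size r != mdeg m)%N -> exists i, (1 < r i)%N.
  by rewrite -sr => /supp_size_ltP.
have col2 : (supp_size c != mdeg m)%N -> exists j, (1 < c j)%N.
  by rewrite -sc => /supp_size_ltP.
move: bad; rewrite /good_margins => bad.
have [rbig|rsmall] := ltnP 2 (supp_size r).
  have [/eqP Ec|/col2 hc] := boolP (supp_size c == mdeg m).
    by apply: row_case; [apply: row2| |]; lia.
  by apply: col_case => //; lia.
(* The row support has size 2 here, so the column support has size at least 3; the degree then
   exceeds 2, which forces a row sum of at least 2. *)
by apply: row_case; [apply: row2| |]; lia.
Qed.

End BadMargins.

(** * Signs on the remaining margins *)

Section Signs.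
Context (n : nat).
Implicit Types (m : 'X_{1..n * n}) (i j k l : 'I_n) (r c : 'I_n -> nat).

Lemma sum_unitm i j (f : 'I_n -> 'I_n -> nat) :
  (\sum_k \sum_l unitm i j (mxvec_index k l) * f k l = f i j)%N.
Proof.
rewrite (bigD1 i) //= [X in (_ + X)%N]big1 ?addn0 => [|k nki]; last first.
  by rewrite big1 // => l _; rewrite unitmE eq_sym (negPf nki).
rewrite (bigD1 j) //= big1 ?addn0 ?unitmE ?eqxx ?mul1n // => l nlj.
by rewrite unitmE [j == l]eq_sym (negPf nlj) andbF.
Qed.

Lemma sum_mnmD m m' (f : 'I_n -> 'I_n -> nat) :
  (\sum_k \sum_l (m + m')%MM (mxvec_index k l) * f k l
   = \sum_k \sum_l m (mxvec_index k l) * f k l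
     + \sum_k \sum_l m' (mxvec_index k l) * f k l)%N.
Proof.
rewrite -big_split; apply: eq_bigr => k _; rewrite -big_split.
by apply: eq_bigr => l _; rewrite mnmDE mulnDl.
Qed.

(** If the support of [f] has two elements, this tells the larger from the smaller without naming
    either. *)
Definition below_supp (f : 'I_n -> nat) k : bool := [exists i : 'I_n, (i < k)%N && (0 < f i)%N].

(* When r and c both have support of size 2, this is the entry of m in the last
   row and last column of the supporting 2 x 2 block. *)
Definition corner_entry r c m : nat :=
  (\sum_k \sum_l m (mxvec_index k l) * (below_supp r k && below_supp c l))%N.

Lemma below_supp_pair f i k : (i < k)%N -> supp_size f = 2%N ->
  (0 < f i)%N -> (0 < f k)%N -> ~~ below_supp f i /\ below_supp f k.
Proof.
move=> ik f2 fi fk; split; last by apply/existsP; exists i; rewrite ik.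
apply/existsP => -[a /andP[ai fa]].
suff: (2 < supp_size f)%N by rewrite f2.
apply/card_gt2P; exists a, i, k; split; first by rewrite !inE.
by rewrite -!(inj_eq val_inj); split; move: ai ik => /=; lia.
Qed.

(** Of the four cells involved only (k, l) is the counted corner, so the swap changes the entry by
    exactly one. *)
Lemma odd_corner_entry_swap r c m i j k l :
    (i < k)%N -> (j < l)%N -> supp_size r = 2%N -> supp_size c = 2%N ->
    (0 < r i)%N -> (0 < r k)%N -> (0 < c j)%N -> (0 < c l)%N ->
  odd (corner_entry r c (m + unitm i l + unitm k j)%MM) =
  ~~ odd (corner_entry r c (m + unitm i j + unitm k l)%MM).
Proof.
move=> ik jl r2 c2 ri rk cj cl; rewrite /corner_entry !sum_mnmD !sum_unitm.
have [/negPf-> ->] := below_supp_pair ik r2 ri rk.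
have [/negPf-> ->] := below_supp_pair jl c2 cj cl.
by rewrite !addn0 addn1 /= negbK.
Qed.

(** Being bilinear, the form lets the effect of a swap on [inversions] be expanded cell by cell. *)
Definition inv_form m m' : nat :=
  (\sum_i \sum_j m (mxvec_index i j) *
     (\sum_k \sum_l m' (mxvec_index k l) * ((i < k) && (l < j))))%N.

(* The number of inversions when m is a partial permutation matrix. *)
Definition inversions m : nat := inv_form m m.

Lemma inv_formDl m1 m2 m :
  inv_form (m1 + m2)%MM m = (inv_form m1 m + inv_form m2 m)%N.
Proof. exact: sum_mnmD. Qed.

Lemma inv_formDr m1 m2 m :
  inv_form m (m1 + m2)%MM = (inv_form m m1 + inv_form m m2)%N.
Proof.
rewrite /inv_form -big_split; apply: eq_bigr => i _; rewrite -big_split.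
by apply: eq_bigr => j _; rewrite sum_mnmD mulnDr.
Qed.

Lemma inv_form_unitm i j k l :
  inv_form (unitm i j) (unitm k l) = (i < k)%N && (l < j)%N :> nat.
Proof. by rewrite /inv_form !sum_unitm. Qed.

(** The cross terms that appear when the cell (i, j) is added to [m] in [inversions]. *)
Definition inv_cross m i j : nat :=
  (inv_form m (unitm i j) + inv_form (unitm i j) m)%N.

Lemma inv_crossE m i j :
  inv_cross m i j = (\sum_p \sum_q m (mxvec_index p q) *
    (((p < i) && (j < q)) + ((i < p) && (q < j))))%N.
Proof.
rewrite /inv_cross /inv_form sum_unitm -big_split; apply: eq_bigr => p _.
rewrite -big_split; apply: eq_bigr => q _.
by rewrite sum_unitm mulnDr.
Qed.

(** An occupied cell (p, q) avoids rows i, k and columns j, l, so it is inverted with (i, j) exactly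
    when one of p < i and q < j holds. Modulo 2 this is a term in i plus a term in j, and both
    pairings of the rows with the columns give the same sum. *)
Lemma odd_inv_cross_swap m i j k l : row_sum m i = 0%N -> row_sum m k = 0%N ->
    col_sum m j = 0%N -> col_sum m l = 0%N ->
  odd (inv_cross m i j + inv_cross m k l) =
  odd (inv_cross m i l + inv_cross m k j).
Proof.
move=> ri rk cj cl.
suff: ~~ odd (inv_cross m i j + inv_cross m k l + (inv_cross m i l + inv_cross m k j)).
  by rewrite oddD negb_add => /eqP.
rewrite -dvdn2.
rewrite !inv_crossE -!big_split /=; apply: dvdn_sum => p _.
rewrite -!big_split /=; apply: dvdn_sum => q _; rewrite -!mulnDr.
have [->|m0] := posnP (m (mxvec_index p q)); first by rewrite mul0n dvdn0.
have row_neq a : row_sum m a = 0%N -> val p != a.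
  move/eqP; rewrite sum_nat_eq0 => /forallP/(_ q) /= ma.
  by apply: contraTneq m0 => /val_inj ->; rewrite -eqn0Ngt.
have col_neq a : col_sum m a = 0%N -> val q != a.
  move/eqP; rewrite sum_nat_eq0 => /forallP/(_ p) /= ma.
  by apply: contraTneq m0 => /val_inj ->; rewrite -eqn0Ngt.
apply: dvdn_mull; move: (row_neq _ ri) (row_neq _ rk) (col_neq _ cj) (col_neq _ cl).
by case: (ltngtP p i); case: (ltngtP p k); case: (ltngtP q j); case: (ltngtP q l).
Qed.

(** The cross terms agree modulo 2, and of the two pairs of new cells only (i, l), (k, j) is itself
    an inversion. *)
Lemma odd_inversions_swap m i j k l : (i < k)%N -> (j < l)%N ->
    row_sum m i = 0%N -> row_sum m k = 0%N ->
    col_sum m j = 0%N -> col_sum m l = 0%N ->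
  odd (inversions (m + unitm i l + unitm k j)%MM) =
  ~~ odd (inversions (m + unitm i j + unitm k l)%MM).
Proof.
move=> ik jl ri rk cj cl; have := odd_inv_cross_swap ri rk cj cl.
rewrite /inversions !inv_formDl !inv_formDr !inv_form_unitm !ltnn !andbF.
rewrite ik jl /= (leq_gtF (ltnW ik)) (leq_gtF (ltnW jl)) /inv_cross.
rewrite !oddD /=.
move: (odd (inv_form m m)) (odd (inv_form m (unitm i j))) (odd (inv_form (unitm i j) m))
 (odd (inv_form m (unitm k l))) (odd (inv_form (unitm k l) m))
 (odd (inv_form m (unitm i l))) (odd (inv_form (unitm i l) m))
 (odd (inv_form m (unitm k j))) (odd (inv_form (unitm k j) m)).
by do 9!case.
Qed.

(** A single supporting row or column admits no swap of distinct rows and columns, so any sign is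
    consistent there and [inversions] serves for that case too. *)
Definition sign_exp r c m : nat :=
  if (supp_size r == 2)%N && (supp_size c == 2)%N then corner_entry r c m
  else inversions m.

(** A swap exhibits two supporting rows and two supporting columns. Good margins outside the 2 x 2
    case are then 0 or 1 throughout, so the remainder [m] is empty in the rows and columns of the
    swap. *)
Lemma odd_sign_exp_swap r c m i j k l : (i < k)%N -> (j < l)%N ->
    row_sum (m + unitm i j + unitm k l)%MM =1 r ->
    col_sum (m + unitm i j + unitm k l)%MM =1 c ->
    good_margins (mdeg (m + unitm i j + unitm k l)%MM) r c ->
  odd (sign_exp r c (m + unitm i l + unitm k j)%MM) =
  ~~ odd (sign_exp r c (m + unitm i j + unitm k l)%MM).
Proof.
move=> ik jl Er Ec good.
have ne_ik : i != k by rewrite -(inj_eq val_inj) neq_ltn ik.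
have ne_jl : j != l by rewrite -(inj_eq val_inj) neq_ltn jl.
have rE a : r a = (row_sum m a + (i == a) + (k == a))%N.
  by rewrite -Er !row_sumD !row_sum_unitm.
have cE a : c a = (col_sum m a + (j == a) + (l == a))%N.
  by rewrite -Ec !col_sumD !col_sum_unitm.
have ri : (0 < r i)%N by rewrite rE eqxx addn1.
have rk : (0 < r k)%N by rewrite rE eqxx addn1.
have cj : (0 < c j)%N by rewrite cE eqxx addn1.
have cl : (0 < c l)%N by rewrite cE eqxx addn1.
rewrite /sign_exp; case: ifP => [/andP[/eqP r2 /eqP c2]|not22].
  exact: odd_corner_entry_swap.
have rgt1 : (1 < supp_size r)%N by apply/card_gt1P; exists i, k.
have cgt1 : (1 < supp_size c)%N by apply/card_gt1P; exists j, l.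
move: good; rewrite /good_margins not22.
rewrite (gtn_eqF rgt1) (gtn_eqF cgt1) /= => /andP[rt ct].
have r1 a : (r a <= 1)%N.
  rewrite leqNgt; apply/negP => ra.
  have /supp_size_ltP : exists a, (1 < r a)%N by exists a.
  by rewrite (eqP rt) mdeg_row_sum (eq_bigr _ (fun b _ => Er b)) eqxx.
have c1 a : (c a <= 1)%N.
  rewrite leqNgt; apply/negP => ca.
  have /supp_size_ltP : exists a, (1 < c a)%N by exists a.
  by rewrite (eqP ct) mdeg_col_sum (eq_bigr _ (fun b _ => Ec b)) eqxx.
apply: odd_inversions_swap => //.
- by have := r1 i; rewrite rE eqxx; lia.
- by have := r1 k; rewrite rE eqxx; lia.
- by have := c1 j; rewrite cE eqxx; lia.
- by have := c1 l; rewrite cE eqxx; lia.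
Qed.
End Signs.

(** * The Hilbert function as a count of margins *)

Section HilbertFunction.
Context (F : fieldType) (n t : nat).
Context (F2 : 2%:R != 0 :> F) (t_gt0 : (0 < t)%N).
Implicit Types (i j k l : 'I_n) (p q : {mpoly F[n * n]}).

Local Notation in_ideal := (ideal_gen (@sub_permanent2 F n)).
(** Row and column sums in degree [t] are at most [t]; bounding the values makes the margins a
    finite type that can be counted. *)
Local Notation margins := ({ffun 'I_n -> 'I_t.+1} * {ffun 'I_n -> 'I_t.+1})%type.
Implicit Types (m : 'X_{1..n * n}) (g : margins).

Definition row_margin g i : nat := g.1 i.
Definition col_margin g j : nat := g.2 j.

Definition has_margins g m : bool :=
  [forall i, row_sum m i == row_margin g i] && [forall j, col_sum m j == col_margin g j].

Lemma has_marginsP g m :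
  reflect (row_sum m =1 row_margin g /\ col_sum m =1 col_margin g) (has_margins g m).
Proof.
apply: (iffP andP) => -[r c]; split.
- by move=> i; apply/eqP/(forallP r).
- by move=> j; apply/eqP/(forallP c).
- by apply/forallP => i; apply/eqP.
- by apply/forallP => j; apply/eqP.
Qed.

Definition good_set : {set margins} :=
  [set g | [&& (\sum_i row_margin g i == t)%N, (\sum_j col_margin g j == t)%N
             & good_margins t (row_margin g) (col_margin g)]].

Lemma good_set_mdeg g m : g \in good_set -> has_margins g m -> mdeg m = t.
Proof.
rewrite inE => /and3P[/eqP <- _ _] /has_marginsP[r _].
by rewrite mdeg_row_sum; apply: eq_bigr => i _; apply: r.
Qed.

Definition sign_of g m : F := (-1) ^+ sign_exp (row_margin g) (col_margin g) m.

(** For good [g] this functional is the coordinate of the quotient belonging to the margins [g].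
    Bounding the degree makes the sum finite and loses nothing, since monomials with these margins
    have degree [t]. *)
Definition fiber_form g p : F :=
  \sum_(m : 'X_{1..(n * n) < t.+1} | has_margins g m) sign_of g m * p@_m.

Lemma fiber_form_is_linear g : linear_for *%R (fiber_form g).
Proof.
move=> a p q; rewrite /fiber_form mulr_sumr -big_split.
by apply: eq_bigr => m _ /=; rewrite mcoeffD mcoeffZ mulrDr mulrCA.
Qed.

HB.instance Definition _ g :=
  GRing.isLinear.Build F {mpoly F[n * n]} F *%R (fiber_form g)
    (fiber_form_is_linear g).

Lemma fiber_formX g m : g \in good_set ->
  fiber_form g 'X_[m] = if has_margins g m then sign_of g m else 0.
Proof.
move=> gg; rewrite /fiber_form; case: ifPn => [gm|ngm].
  have lt_m : (mdeg m < t.+1)%N by rewrite (good_set_mdeg gg gm).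
  rewrite (bigD1 (BMultinom lt_m)) //= mcoeffX eqxx mulr1 big1 ?addr0 // => m'.
  by case/andP=> _; rewrite bmeqP eq_sym mcoeffX /= => /negPf->; rewrite mulr0.
apply: big1 => m' gm'; rewrite mcoeffX; case: eqP => [mm'|]; last by rewrite mulr0.
by rewrite mm' gm' in ngm.
Qed.

(** The two terms of a monomial multiple of a generator differ by a swap: they have the same margins
    and opposite signs, and cancel. *)
Lemma fiber_form_ideal g p : g \in good_set -> in_ideal p -> fiber_form g p = 0.
Proof.
move=> gg [s [Gs ->]]; rewrite linear_sum big_seq big1 // => u /Gs.
case=> i [k [j [l [ik jl ->]]]].
(* By linearity the cofactor of the generator may be taken to be a monomial. *)
rewrite {1}(mpolyE u.1) mulr_suml linear_sum big1 //= => m _.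
rewrite -scalerAl linearZ /= mulrDr linearD /=.
have -> : 'X_[m] * (coord_var F i j * coord_var F k l) =
  'X_[m + unitm i j + unitm k l] by rewrite !mpolyX_unitm mulrA.
have -> : 'X_[m] * (coord_var F i l * coord_var F k j) =
  'X_[m + unitm i l + unitm k j] by rewrite !mpolyX_unitm mulrA.
rewrite !fiber_formX //.
have [swr swc] := same_margins_swap m i j k l.
have -> : has_margins g (m + unitm i l + unitm k j)%MM =
          has_margins g (m + unitm i j + unitm k l)%MM.
  by apply/has_marginsP/has_marginsP => -[r c]; split=> a; rewrite ?swr ?swc // -?swr -?swc.
case: ifPn => [gm|_]; last by rewrite addr0 mulr0.
have sgnE := @odd_sign_exp_swap n (row_margin g) (col_margin g) m i j k l ik jl.
have [r c] := has_marginsP _ _ gm.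
rewrite /sign_of -signr_odd -[X in _ + X]signr_odd sgnE //.
  by rewrite signrN addrN mulr0.
by rewrite (good_set_mdeg gg gm); move: gg; rewrite inE => /and3P[].
Qed.

Lemma good_set_inhabited g : g \in good_set -> exists m, has_margins g m.
Proof.
rewrite inE => /and3P[/eqP sr /eqP sc _].
have [|m [r c]] := @exists_margins n (row_margin g) (col_margin g); first by rewrite sr sc.
by exists m; apply/has_marginsP.
Qed.

Lemma sign_ofK g m : sign_of g m * sign_of g m = 1.
Proof. by rewrite -expr2 sqrr_sign. Qed.

(** [same_margins_eq_mod] gives a congruence with an unknown sign; applying [fiber_form], which
    vanishes on the ideal, determines that sign. *)
Lemma has_margins_eq_mod g m m' : g \in good_set ->
    has_margins g m -> has_margins g m' ->
  in_ideal ('X_[m] - (sign_of g m * sign_of g m') *: 'X_[m']).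
Proof.
move=> gg gm gm'; have [r c] := has_marginsP _ _ gm.
have [r' c'] := has_marginsP _ _ gm'.
have [|b Ib] := @same_margins_eq_mod F n m m'.
  by split=> a; rewrite ?r ?r' ?c ?c'.
have def_b : (-1) ^+ b * 'X_[m'] = ((-1) ^+ b) *: 'X_[m'] :> {mpoly F[n * n]}.
  by rewrite -mul_mpolyC rmorphXn /= rmorphN1.
rewrite def_b in Ib; have := fiber_form_ideal gg Ib.
rewrite linearB linearZ /= !fiber_formX // gm gm' => /eqP.
by rewrite subr_eq0 => /eqP->; rewrite -mulrA sign_ofK mulr1.
Qed.

Lemma ideal_gen_sum (I : Type) (s : seq I) (P : pred I) (f : I -> {mpoly F[n * n]}) :
  (forall a, P a -> in_ideal (f a)) -> in_ideal (\sum_(a <- s | P a) f a).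
Proof.
move=> If; elim/big_rec: _ => [|a p Pa Ip]; first exact: ideal_gen0.
by apply: ideal_genD => //; apply: If.
Qed.

Lemma ideal_genZ a p : in_ideal p -> in_ideal (a *: p).
Proof. by rewrite -mul_mpolyC; apply: ideal_genM. Qed.

Definition margins_of m : margins :=
  ([ffun i => inord (row_sum m i)], [ffun j => inord (col_sum m j)]).

Lemma margins_ofP m : (mdeg m <= t)%N -> has_margins (margins_of m) m.
Proof.
move=> mt; apply/has_marginsP; split=> a; rewrite /row_margin /col_margin /= ffunE inordK // ltnS.
  by apply: leq_trans mt; rewrite mdeg_row_sum (bigD1 a) //= leq_addr.
by apply: leq_trans mt; rewrite mdeg_col_sum (bigD1 a) //= leq_addr.
Qed.

Lemma margins_of_uniq g m : has_margins g m -> margins_of m = g.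
Proof.
move=> /has_marginsP[r c]; case: g r c => g1 g2; rewrite /row_margin /col_margin /= => r c; congr (_, _).
  by apply/ffunP=> i; apply/val_inj; rewrite ffunE r inord_val.
by apply/ffunP=> i; apply/val_inj; rewrite ffunE c inord_val.
Qed.

(** The polynomial is split by margins. Over bad margins each term lies in the ideal; over good
    margins everything reduces to one base monomial, with coefficient the value of [fiber_form] up
    to sign. *)
Lemma ideal_of_fiber_form p : p \is t.-homog ->
  (forall g, g \in good_set -> fiber_form g p = 0) -> in_ideal p.
Proof.
move=> hp p0.
have coef0 m : mdeg m != t -> p@_m = 0.
  by move=> mt; apply: (dhomog_nemf_coeff hp).
have le_p : (msize p <= t.+1)%N.
  by rewrite msizeE; apply/bigmax_leqP_seq => m pm _; rewrite ltnS ((dhomogP _ _ _ hp) m pm).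
rewrite (mpolywE le_p).
rewrite (partition_big (fun m : 'X_{1..(n * n) < t.+1} => margins_of m) predT) //=.
apply: ideal_gen_sum => g _.
have [gg|bg] := boolP (g \in good_set); last first.
  apply: ideal_gen_sum => m /eqP mg; have [mt|/coef0->] := eqVneq (mdeg m) t; last first.
    by rewrite scale0r; apply: ideal_gen0.
  apply: ideal_genZ; apply: bad_margins_in_ideal => //; rewrite mt //.
  apply: contra bg => good_m.
  have /has_marginsP[] : has_margins g m by rewrite -mg margins_ofP ?mt.
  move=> r c; rewrite inE -(eq_good_margins _ r c) good_m andbT.
  rewrite -(eq_bigr _ (fun i _ => r i)) -(eq_bigr _ (fun i _ => c i)).
  by rewrite -mdeg_row_sum -mdeg_col_sum mt eqxx.
(* The base monomial of the fiber. *)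
have [m0 gm0] := good_set_inhabited gg.
have fiberE (m : 'X_{1..(n * n) < t.+1}) : true && (margins_of m == g) = has_margins g m.
  apply/eqP/idP => [<-|/margins_of_uniq //].
  by apply: margins_ofP; rewrite -ltnS bmdeg.
rewrite (eq_bigl _ _ fiberE).
have -> : \sum_(m : 'X_{1..(n * n) < t.+1} | has_margins g m) p@_m *: 'X_[m] =
    \sum_(m : 'X_{1..(n * n) < t.+1} | has_margins g m)
      p@_m *: ('X_[m] - (sign_of g m * sign_of g m0) *: 'X_[m0])
    + (fiber_form g p * sign_of g m0) *: 'X_[m0].
  rewrite /fiber_form mulr_suml scaler_suml -big_split; apply: eq_bigr => m _ /=.
  by rewrite scalerBr scalerA mulrCA mulrA subrK.
rewrite p0 // mul0r scale0r addr0; apply: ideal_gen_sum => m gm.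
by apply: ideal_genZ; apply: has_margins_eq_mod.
Qed.

Definition fiber_forms (p : sym_pow F (n * n) t) : 'rV[F]_#|good_set| :=
  \row_a fiber_form (enum_val a) (sym_pow_val p).

Lemma fiber_forms_is_linear : linear fiber_forms.
Proof.
move=> a p q; apply/rowP => b; rewrite !mxE.
exact: (fiber_form_is_linear (enum_val b) a (sym_pow_val p) (sym_pow_val q)).
Qed.

HB.instance Definition _ :=
  GRing.isLinear.Build F (sym_pow F (n * n) t) 'rV[F]_#|good_set| *:%R fiber_forms
    fiber_forms_is_linear.

Lemma lker_fiber_forms : lker (linfun fiber_forms) = perm_ideal_component F n t.
Proof.
apply/vspaceP => p; rewrite memv_ker lfunE /=.
apply/eqP/idP => [p0|/mem_ideal_component Ip].
  apply/mem_ideal_component; apply: ideal_of_fiber_form => [|g gg]; first exact: dhomog_is_dhomog.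
  by move/rowP/(_ (enum_rank_in gg g)): p0; rewrite !mxE enum_rankK_in.
by apply/rowP => a; rewrite !mxE; apply: fiber_form_ideal => //; apply: enum_valP.
Qed.

(** A monomial with margins [g], multiplied by its sign, maps to the basis vector of [g], because
    fibers over distinct margins are disjoint. *)
Lemma limg_fiber_forms : limg (linfun fiber_forms) = fullv.
Proof.
apply/eqP; rewrite eqEsubv subvf /=; apply/subvP => v _.
rewrite (row_sum_delta v); apply: memv_suml => a _; apply: memvZ.
have [m gm] := good_set_inhabited (enum_valP a).
have hm : 'X_[m] \is [in F[n * n], t.-homog].
  by rewrite dhomogX; apply/eqP; apply: good_set_mdeg (enum_valP a) gm.
suff -> : 'e_a = linfun fiber_forms
    (sign_of (enum_val a) m *: (DHomog hm : sym_pow F (n * n) t)).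
  exact: memv_img (memvf _).
rewrite lfunE /= linearZ; apply/rowP => b; rewrite !mxE /= fiber_formX ?enum_valP //.
have [->|nab] := eqVneq b a; first by rewrite gm sign_ofK.
case: ifP => [gm'|]; last by rewrite mulr0.
case/eqP: nab; apply: enum_val_inj.
by rewrite -(margins_of_uniq gm) -(margins_of_uniq gm').
Qed.

Lemma dim_perm_ideal_component :
  (\dim (perm_ideal_component F n t) + #|good_set| = \dim {:sym_pow F (n * n) t})%N.
Proof.
rewrite -(limg_ker_dim (linfun fiber_forms) fullv) capfv lker_fiber_forms.
by rewrite limg_fiber_forms [in RHS]dimvf /dim /= mul1n.
Qed.

End HilbertFunction.

(** * Counting compositions *)

Section Compositions.

Lemma hockey_stick s u : (\sum_(k < u) 'C(k, s) = 'C(u, s.+1))%N.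
Proof.
by elim: u => [|u IH]; rewrite ?big_ord0 ?bin0n // big_ord_recr /= IH binS addnC.
Qed.

(** The generating function of one positive part, cut at degree [t]; coefficients of its powers up
    to that degree are unaffected by the cut. *)
Definition positive_powers t : {poly int} := \sum_(v < t) 'X^(v.+1).

Lemma coef_positive_powers t u : (positive_powers t)`_u = (0 < u <= t)%N%:R.
Proof.
rewrite coef_sum; case: u => [|u]; first by rewrite big1 // => v _; rewrite coefXn.
have [ut|tu] := ltnP u t.
  rewrite (bigD1 (Ordinal ut)) //= coefXn eqxx big1 ?addr0 ?ut // => v nv.
  by rewrite coefXn eqSS -[u]/(val (Ordinal ut)) (inj_eq val_inj) eq_sym (negPf nv).
rewrite big1 ?ltnNge ?tu // => v _; rewrite coefXn eqSS gtn_eqF //.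
exact: leq_trans (ltn_ord v) tu.
Qed.

(** This counts compositions of [u] into [s.+1] positive parts. Summing over the last part turns the
    induction into the hockey-stick identity. *)
Lemma coef_positive_powers_exp t s u : (u <= t)%N ->
  (positive_powers t ^+ s.+1)`_u = (if u is u'.+1 then 'C(u', s) else 0)%:R.
Proof.
elim: s u => [|s IH] u ut.
  by rewrite expr1 coef_positive_powers; case: u ut => [|u] // ->; rewrite bin0.
rewrite exprSr coefM; case: u ut => [|u] ut.
  by rewrite big_ord1 IH // mul0r.
rewrite big_ord_recl IH // mul0r add0r big_ord_recr /= coef_positive_powers.
rewrite subnn mulr0 addr0 -hockey_stick natr_sum; apply: eq_bigr => k _.
rewrite /bump /= add1n subSS IH; last exact: leq_trans (ltn_ord k) (ltnW ut).
rewrite coef_positive_powers subn_gt0 ltn_ord /=.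
by rewrite (leq_trans (leq_subr _ _) (ltnW ut)) mulr1.
Qed.

Definition compositions n t : {set {ffun 'I_n -> 'I_t.+1}} :=
  [set f : {ffun 'I_n -> 'I_t.+1} | (\sum_i f i == t)%N].

Definition compositions_supp n t s : {set {ffun 'I_n -> 'I_t.+1}} :=
  [set f in compositions n t | supp_size (fun i => f i : nat) == s].

(* Both sides are the coefficient of x^t y^s in (1 + y (x + ... + x^t))^n. *)
Lemma card_compositions_supp n t s :
  #|compositions_supp n t.+1 s.+1| = ('C(n, s.+1) * 'C(t, s))%N.
Proof.
(* The inner variable x records the value of a part, the outer variable y whether it is positive. *)
pose w (v : 'I_t.+2) : {poly {poly int}} := ('X^v)%:P * 'X^(0 < v)%N.
have wE (f : {ffun 'I_n -> 'I_t.+2}) : \prod_i w (f i) =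
    ('X^(\sum_i f i)%N)%:P * 'X^(supp_size (fun i => f i)).
  rewrite big_split /= -rmorph_prod -!expr_sum; congr (_ * 'X^_).
  by rewrite /supp_size -sum1_card [RHS]big_mkcond; apply: eq_bigr => i _; rewrite inE; case: ltnP.
have sum_w : \sum_v w v = (positive_powers t.+1)%:P * 'X + 1.
  rewrite big_ord_recl addrC /w expr0 mul1r rmorph_sum mulr_suml.
  by congr (_ + _); apply: eq_bigr.
have : (\prod_(i < n) \sum_v w v)`_s.+1`_t.+1 =
    (\sum_(f : {ffun 'I_n -> 'I_t.+2}) \prod_i w (f i))`_s.+1`_t.+1.
  by rewrite bigA_distr_bigA.
rewrite prodr_const card_ord sum_w exprD1n !coef_sum.
have term (i : nat) : (((positive_powers t.+1)%:P * 'X) ^+ i *+ 'C(n, i))`_s.+1`_t.+1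
    = (i == s.+1)%:R * ('C(n, s.+1) * 'C(t, s))%:R :> int.
  rewrite exprMn -rmorphXn /= coefMn coefMXn.
  have [->|nis] := eqVneq i s.+1.
    rewrite ltnn subnn coefC eqxx coefMn coef_positive_powers_exp //.
    by rewrite mul1r mulnC mulrnA.
  case: ltnP => [_|lis]; first by rewrite mul0rn coef0 mul0r.
  by rewrite coefC subn_eq0 leqNgt ltn_neqAle nis lis mul0rn coef0 mul0r.
rewrite (eq_bigr _ (fun (i : 'I_n.+1) _ => term i)).
have -> : \sum_(i < n.+1) (i == s.+1 :> nat)%:R * ('C(n, s.+1) * 'C(t, s))%:R
    = ('C(n, s.+1) * 'C(t, s))%:R :> int.
  have [sn|ns] := ltnP s n; last first.
    rewrite bin_small // mul0n big1 // => i _; exact: mulr0.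
  rewrite (bigD1 (inord s.+1)) //= inordK // eqxx mul1r big1 ?addr0 // => i ni.
  case: eqP => [ei|_]; last exact: mul0r.
  by case/eqP: ni; apply: val_inj; rewrite /= inordK.
have termf (f : {ffun 'I_n -> 'I_t.+2}) : (\prod_i w (f i))`_s.+1`_t.+1 =
    (f \in compositions_supp n t.+1 s.+1)%:R :> int.
  rewrite wE coefMXn !inE.
  have [<-|nis] := eqVneq (supp_size (fun i => f i)) s.+1.
    by rewrite ltnn subnn coefC eqxx coefXn andbT eq_sym.
  rewrite andbF; case: ltnP => [_|lis]; first by rewrite coef0.
  by rewrite coefC subn_eq0 leqNgt ltn_neqAle nis lis coef0.
rewrite (eq_bigr _ (fun f _ => termf f)) -natr_sum -sum1_card.
move/eqP; rewrite eqr_nat => /eqP ->.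
by rewrite [LHS]big_mkcond; apply: eq_bigr => f _; case: ifP.
Qed.

Lemma card_compositions n t :
  #|compositions n t.+1| = (\sum_(j < t.+1) 'C(n, j.+1) * 'C(t, j))%N.
Proof.
rewrite -sum1_card (partition_big (fun f : {ffun 'I_n -> 'I_t.+2} =>
  inord (supp_size (fun i => f i)) : 'I_t.+2) predT) //= big_ord_recl.
(* An empty support is impossible because the total is positive. *)
rewrite [X in (X + _)%N]big1 ?add0n => [|f]; last first.
  rewrite inE => /andP[/eqP sf /eqP/(congr1 val)].
  have := supp_size_le (fun i => f i : nat); rewrite sf => f_le.
  rewrite /= inordK // => f0.
  by have := @supp_size_gt0 n (fun i => f i); rewrite sf f0 => /(_ isT).
apply: eq_bigr => j _; rewrite -card_compositions_supp -sum1_card.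
apply: eq_bigl => f; rewrite !inE; case: eqP => //= sf.
have := supp_size_le (fun i => f i : nat); rewrite sf => f_le.
by rewrite -(inj_eq val_inj) /= inordK.
Qed.

(** Inclusion-exclusion in degree [t.+1]. Pairs with both supports of size 1 are counted twice,
    whence [n ^ 2], kept on the left to avoid truncated subtraction. The 2 x 2 and the 0/1 margins
    coincide in degree 2, that is for [t = 1], and are disjoint otherwise. *)
Lemma card_good_set n t : (0 < t)%N ->
  (#|good_set n t.+1| + n ^ 2 =
   2 * n * (\sum_(j < t.+1) 'C(n, j.+1) * 'C(t, j)) + ('C(n, 2) * t) ^ 2
   + (if t == 1%N then 0 else 'C(n, t.+1) ^ 2))%N.
Proof.
move=> t0; rewrite -card_compositions.
set A := compositions n t.+1; pose S := compositions_supp n t.+1.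
pose U := setX (S 1%N) A :|: setX A (S 1%N).
pose V := setX (S 2%N) (S 2%N) :|: setX (S t.+1) (S t.+1).
have goodE : good_set n t.+1 = U :|: V.
  apply/setP => -[f g]; rewrite !inE /good_margins /row_margin /col_margin /=.
  case: (\sum_i f i == t.+1)%N; case: (\sum_i g i == t.+1)%N => //=.
    by rewrite andbT orbA.
  by rewrite !andbF.
have disj : [disjoint U & V].
  apply/pred0P => -[f g]; rewrite /= !inE /=.
  case: (\sum_i f i == t.+1)%N; case: (\sum_i g i == t.+1)%N => //=; lia.
have cardU : (#|U| + n ^ 2 = 2 * n * #|A|)%N.
  have SI : setX (S 1%N) A :&: setX A (S 1%N) = setX (S 1%N) (S 1%N).
    apply/setP => -[f g]; rewrite !inE /=.
    by case: (\sum_i f i == t.+1)%N; case: (\sum_i g i == t.+1)%N; rewrite /= ?andbF ?andbT.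
  have := cardsUI (setX (S 1%N) A) (setX A (S 1%N)).
  rewrite SI !cardsX card_compositions_supp bin1 bin0 muln1 -/U => UE.
  by rewrite -mulnn UE; lia.
have cardV : (#|V| = ('C(n, 2) * t) ^ 2 + (if t == 1%N then 0 else 'C(n, t.+1) ^ 2))%N.
  rewrite /V; case: eqP => [t1|/eqP t1].
    rewrite (congr1 (fun u => S u.+1) t1 : S t.+1 = S 2%N).
    by rewrite setUid cardsX card_compositions_supp bin1 mulnn addn0.
  rewrite cardsU !cardsX !card_compositions_supp bin1 binn muln1 !mulnn.
  rewrite [_ :&: _](_ : _ = set0) ?cards0 ?subn0 //.
  apply/setP => -[f g]; rewrite !inE /=.
  by lia.
rewrite goodE cardsU; rewrite (disjoint_setI0 disj) cards0 subn0.
by rewrite -addnA [(#|V| + _)%N]addnC addnA cardU cardV addnA.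
Qed.

End Compositions.

(** * Dimension formulas *)

Section DimensionFormula.
Context (F : fieldType) (n : nat) (F2 : 2%:R != 0 :> F).

Lemma dim_sym_pow N t : \dim {:sym_pow F N t} = 'C((N + t).-1, t).
Proof. by rewrite dimvf. Qed.

Lemma hilbert_functionE t : (0 < t)%N ->
  hilbert_function (@sub_permanent2 F n) t = #|good_set n t|.
Proof.
by move=> t0; rewrite /hilbert_function -(dim_perm_ideal_component n F2 t0) addKn.
Qed.

Lemma double_bin2 m : (2 * 'C(m, 2) = m * m.-1)%N.
Proof.
rewrite bin2 mul2n even_halfK //; case: m => //= m.
by rewrite oddM /= andNb.
Qed.

(** Two cells of an m x m grid share a row or a column, or form one of the two diagonals of a
    rectangle. *)
Lemma bin2_sqr m : ('C(m ^ 2, 2) = 2 * m * 'C(m, 2) + 2 * 'C(m, 2) ^ 2)%N.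
Proof.
apply/eqP; rewrite -(eqn_pmul2l (ltn0Sn 1)) double_bin2 mulnDr.
have -> : (2 * (2 * m * 'C(m, 2)) = 2 * m * (2 * 'C(m, 2)))%N by lia.
have -> : (2 * (2 * 'C(m, 2) ^ 2) = (2 * 'C(m, 2)) ^ 2)%N.
  by rewrite -!mulnn; lia.
by rewrite double_bin2 -!mulnn; apply/eqP; case: m => //= m; nia.
Qed.

Lemma dim_formula_smallE t : (2 < t)%N ->
  (\dim (perm_ideal_component F n t))%:Z = dim_formula_small n t.
Proof.
case: t => [|[|[|t]]] // _.
have := dim_perm_ideal_component n F2 (ltn0Sn t.+2).
have := @card_good_set n t.+2 isT.
rewrite dim_sym_pow -(big_mkord xpredT (fun j => 'C(n, j.+1) * 'C(t.+2, j)))%N.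
(* The terms j = 0, 1, 2 are split off, since the target formula displays them separately. *)
rewrite big_ltn // big_ltn // big_ltn // bin0 bin1 muln1 bin1 /=.
rewrite /dim_formula_small bin2_sqr.
have -> : (n * n + t.+3).-1 = (n ^ 2 + t.+3 - 1)%N by rewrite mulnn subn1.
have -> : (t.+3 - 1 = t.+2)%N by rewrite subn1.
have -> : \sum_(3 <= j < t.+3) ('C(t.+2, j))%:Z * ('C(n, j + 1))%:Z
        = (\sum_(3 <= j < t.+3) 'C(n, j.+1) * 'C(t.+2, j))%N%:Z.
  rewrite -natz natr_sum; apply: eq_bigr => j _.
  by rewrite natz PoszM mulrC addn1.
have bt := double_bin2 t.+2.
(* With d the degree, (d-1)^2 = (d-1) + 2 C(d-1, 2) distributes the 2 x 2 contribution over two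
   terms of the formula. *)
have sqt : ('C(n, 2) ^ 2 * (t.+2 * t.+2) = 'C(n, 2) ^ 2 * (t.+2 + 2 * 'C(t.+2, 2)))%N.
  by rewrite bt -mulnS.
move: sqt; clear bt; rewrite -!mulnn.
set S := (\sum_(3 <= j < t.+3) _)%N; set c := 'C(t.+2, 2); set a := 'C(n, 2).
set b := 'C(n, 3); set e := 'C(n, t.+3).
set D := \dim _; set G := #|_|; set T := 'C(_, _).
rewrite !exprS expr0.
clearbody S c a b e D G T; move=> *.
lia.
Qed.

Lemma dim_formula_largeE t : (n < t)%N -> dim_formula_large n t = dim_formula_small n t.
Proof.
move=> nt; by rewrite /dim_formula_small (bin_small nt) (_ : 0%N%:Z ^+ 2 = 0) // add0r.
Qed.

Lemma dim_perm_ideal2 : \dim (perm_ideal_component F n 2) = ('C(n, 2) ^ 2)%N.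
Proof.
have := dim_perm_ideal_component n F2 (ltn0Sn 1).
have := @card_good_set n 1 isT.
rewrite dim_sym_pow !big_ord_recr big_ord0 /= bin0 !bin1 addn0 !muln1.
set D := \dim _; set G := #|_|; clearbody D G.
rewrite addnS addn1 /= binS bin1 mulnn bin2_sqr -!mulnn; lia.
Qed.

(** The binomial C(X - 1, j) as a polynomial; the shift by one comes from the count C(t-1, j) of
    compositions with j + 1 positive parts. *)
Definition bin_poly j : {poly rat} :=
  (j`!%:R)^-1 *: \prod_(i < j) ('X - i.+1%:R%:P).

Lemma bin_polyE j t : (bin_poly j).[t.+1%:R] = 'C(t, j)%:R.
Proof.
rewrite hornerZ horner_prod.
have -> : \prod_(i < j) ('X - i.+1%:R%:P).[t.+1%:R] = (t ^_ j)%:R :> rat.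
  elim: j => [|j IH]; first by rewrite big_ord0 ffactn0.
  rewrite big_ord_recr /= IH ffactnSr hornerXsubC natrM.
  have [jt|tj] := leqP j t; first by rewrite natrB // -!natr1 opprD addrACA subrr addr0.
  by rewrite ffact_small // !mul0r.
rewrite -bin_ffact natrM mulrC mulfK // pnatr_eq0 -lt0n; exact: fact_gt0.
Qed.

(** The count of good margins in degrees above [n], where 0/1 margins no longer exist. The sum stops
    at [n] since C(n, j+1) vanishes from there on, so its range does not depend on the degree. *)
Definition perm_hilbert_poly : {poly rat} :=
  (2 * n)%:R *: (\sum_(j < n) 'C(n, j.+1)%:R *: bin_poly j)
  + ('C(n, 2) ^ 2)%:R *: ('X - 1%:P) ^+ 2 - (n ^ 2)%:R%:P.

Lemma perm_hilbert_polyE t : (1 < n < t)%N ->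
  (hilbert_function (@sub_permanent2 F n) t)%:R = perm_hilbert_poly.[t%:R].
Proof.
case: t => [|t] /andP[n1 nt] //; rewrite hilbert_functionE //.
have t1 : (1 < t)%N by apply: leq_trans n1 _.
have := card_good_set n (ltnW t1).
rewrite (gtn_eqF t1) (bin_small nt) exp0n // addn0.
have -> : (\sum_(j < t.+1) 'C(n, j.+1) * 'C(t, j) =
    \sum_(j < n) 'C(n, j.+1) * 'C(t, j))%N.
  rewrite (big_ord_widen t.+1 (fun j => 'C(n, j.+1) * 'C(t, j))%N (ltnW nt)).
  rewrite [RHS]big_mkcond; apply: eq_bigr => j _.
  by case: ltnP => // nj; rewrite bin_small.
move/(congr1 (fun k => k%:R : rat)); rewrite !natrD => /(canRL (addrK _)) ->.
rewrite /perm_hilbert_poly !hornerE horner_sum natrM natr_sum.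
congr (_ * _ + _ - _).
  by apply: eq_bigr => j _; rewrite hornerZ bin_polyE natrM.
by rewrite -natr1 addrK expnMn natrM [(t ^ 2)%:R]natrX expr2; apply: mulrA.
Qed.

End DimensionFormula.

Lemma horner_nat_eq0 (p : {poly rat}) (t0 : nat) :
  (forall t, (t0 <= t)%N -> p.[t%:R] = 0) -> p = 0.
Proof.
move=> p0; have [//|pn0] := eqVneq p 0.
(* These are [size p] distinct roots, one more than the degree of a nonzero [p]. *)
pose rs : seq rat := [seq k%:R | k <- iota t0 (size p)].
have : ~~ (size rs < size p)%N by rewrite size_map size_iota ltnn.
case/negP; apply: max_poly_roots => //.
  by apply/allP => x /mapP[k]; rewrite mem_iota => /andP[k0 _] ->; apply/eqP/p0.
by rewrite map_inj_uniq ?iota_uniq // => k l /eqP; rewrite eqr_nat => /eqP.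
Qed.

Theorem theorem1p2 (R : realType) (n : nat) (hn : (2 <= n)%N) :
  [/\ \dim (perm_ideal_component R[i] n 2) = ('C(n, 2) ^ 2)%N,
      forall t : nat, (3 <= t <= n)%N ->
        (\dim (perm_ideal_component R[i] n t))%:Z = dim_formula_small n t,
      forall t : nat, (n < t)%N ->
        (\dim (perm_ideal_component R[i] n t))%:Z = dim_formula_large n t,
      exists P : {poly rat}, is_hilbert_polynomial (@sub_permanent2 R[i] n) P
    & forall P : {poly rat}, is_hilbert_polynomial (@sub_permanent2 R[i] n) P ->
        forall t : nat, (n < t)%N ->
        (dim_formula_large n t)%:~R
          = (\dim {:sym_pow R[i] (n * n) t})%:R - P.[t%:R] ].
Proof.
have C2 : 2%:R != 0 :> R[i] by rewrite pnatr_eq0.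
have largeE t : (n < t)%N ->
    (\dim (perm_ideal_component R[i] n t))%:Z = dim_formula_large n t.
  move=> nt; rewrite dim_formula_largeE //; apply: dim_formula_smallE => //.
  exact: leq_ltn_trans hn nt.
split=> //.
- exact: dim_perm_ideal2.
- by move=> t /andP[t3 _]; apply: dim_formula_smallE.
- exists (perm_hilbert_poly n); exists n.+1 => t nt.
  by apply: perm_hilbert_polyE => //; rewrite hn.
move=> P [t0 hP] t nt.
(* Two Hilbert polynomials agree at all large naturals, hence coincide. The explicit one is correct
   from [n.+1] on, whatever the threshold [t0] attached to [P]. *)
have -> : P = perm_hilbert_poly n.
  apply/eqP; rewrite -subr_eq0; apply/eqP.
  apply: (@horner_nat_eq0 _ (maxn t0 n.+1)) => u; rewrite geq_max => /andP[t0u nu].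
  by rewrite hornerD hornerN -hP // (perm_hilbert_polyE C2) ?hn // subrr.
rewrite -(perm_hilbert_polyE C2) ?hn // -largeE // hilbert_functionE //; last first.
  exact: leq_ltn_trans (leq0n n) nt.
by rewrite -(dim_perm_ideal_component n C2 (leq_ltn_trans (leq0n n) nt)) natrD addrK.
Qed.
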